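(* Let $G$ be a connected threshold graph. Then $q(G)=2$ if and only if there exists a matrix $A\in S(G)$ such that $A(\bar{1},\bar{0})$ is column orthogonal.
   Context: All matrices are real. For a simple graph $G$ on $n$ vertices, $S(G)$ is the set of all real symmetric $n\times n$ matrices $A=(a_{ij})$, with rows and columns indexed by the vertices, such that for $i\neq j$, $a_{ij}\neq 0$ if and only if $ij\in E(G)$ (diagonal entries are unrestricted). $q(A)$ is the number of distinct eigenvalues of $A$ and $q(G)=\min\{q(A): A\in S(G)\}$. A threshold graph with creation sequence $(b_1,\ldots,b_n)$, where $b_i\in\{0,1\}$ and by convention $b_1=0$, is the graph on vertices $v_1,\ldots,v_n$ in which, for $i<j$, $v_i$ and $v_j$ are adjacent if and only if $b_j=1$; it is connected when $b_n=1$, and connected threshold graphs are always taken with $b_n=1$ (so $n\ge 2$). Vertices $v_i$ with $b_i=1$ are called dominating and those with $b_i=0$ (including $v_1$) are called isolated. The trace $T$ of $G$ is the number of indices $i$ with $b_i=1$. For $A\in S(G)$, $A(\bar{1},\bar{0})$ denotes the $T\times(n-T)$ submatrix of $A$ with rows indexed by the dominating vertices and columns indexed by the isolated vertices. A matrix is column orthogonal if its columns are pairwise orthogonal (not necessarily of unit length). *)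

(* Defs.v *)
From HB Require Import structures.
From mathcomp Require Import all_boot all_order all_algebra.
From mathcomp Require Import finmap all_classical all_reals.

Set Implicit Arguments.
Unset Strict Implicit.
Unset Printing Implicit Defensive.

Import Order.TTheory GRing.Theory Num.Theory.

Local Open Scope classical_set_scope.
Local Open Scope ring_scope.

Record sgraph (n : nat) := SGraph {
  adj :> rel 'I_n;
  adj_sym : symmetric adj;
  adj_irr : irreflexive adj }.

(* The set S(G) of real symmetric matrices with off-diagonal pattern G. *)
Definition symmx_of (R : realType) (n : nat) (G : sgraph n) : set 'M[R]_n :=
  [set A | A^T = A /\ forall i j, i != j -> (A i j != 0) = adj G i j].

Arguments symmx_of R {n} G.

Lemma finite_eigenvalues (R : realType) (n : nat) (A : 'M[R]_n) :
  finite_set [set a | eigenvalue A a].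
Proof.
apply: contrapT => /(infinite_set_fset (size (char_poly A)))[X XA sX].
have p0 : char_poly A != 0 by rewrite monic_neq0 ?char_poly_monic.
have := @max_poly_roots _ _ X p0; rewrite fset_uniq => /(_ _ isT) ltX.
suff /ltX : all (root (char_poly A)) X by rewrite ltnNge sX.
by apply/allP => a aX; rewrite -eigenvalue_root_char; apply: XA.
Qed.

(* q(A). [fset_set] is junk on infinite sets, whence finite_eigenvalues. *)
Definition num_eigenvalues (R : realType) (n : nat) (A : 'M[R]_n) : nat :=
  #|` fset_set [set a | eigenvalue A a]|%fset.

Lemma graph_q_subproof (R : realType) (n : nat) (G : sgraph n) :
  exists k, `[< exists2 A, symmx_of R G A & num_eigenvalues A = k >].
Proof.
pose A : 'M[R]_n := \matrix_(i, j) (adj G i j)%:R.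
exists (num_eigenvalues A); apply/asboolP; exists A => //; split.
  by apply/matrixP => i j; rewrite !mxE adj_sym.
by move=> i j _; rewrite mxE pnatr_eq0; case: (adj G i j).
Qed.

(* q(G), the least k such that q(A) = k for some A in S(G). *)
Definition graph_q (R : realType) (n : nat) (G : sgraph n) : nat :=
  ex_minn (graph_q_subproof R G).

(* Vertex v_(i+1) is the ordinal i, and b_(i+1) is [tnth b i]; the entry b_1
   is never used, and the convention b_1 = 0 is left to the users. *)
Definition threshold_adj (n : nat) (b : n.-tuple bool) : rel 'I_n :=
  fun i j => if (i < j)%N then tnth b j else if (j < i)%N then tnth b i
             else false.

Lemma threshold_adj_sym (n : nat) (b : n.-tuple bool) :
  symmetric (threshold_adj b).
Proof. by move=> i j; rewrite /threshold_adj; case: ltngtP. Qed.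

Lemma threshold_adj_irr (n : nat) (b : n.-tuple bool) :
  irreflexive (threshold_adj b).
Proof. by move=> i; rewrite /threshold_adj ltnn. Qed.

Definition threshold (n : nat) (b : n.-tuple bool) : sgraph n :=
  SGraph (threshold_adj_sym b) (threshold_adj_irr b).

Lemma threshold_connectedP (n : nat) (b : n.+2.-tuple bool) :
  reflect (forall i j, connect (threshold b) i j) (tnth b ord_max).
Proof.
apply: (iffP idP) => [bn i j | conn].
  have to_max k : connect (threshold b) k ord_max.
    have [->|kn] := eqVneq k ord_max; first exact: connect0.
    by apply: connect1; rewrite /= /threshold_adj ltn_neqAle kn -ltnS ltn_ord.
  have csym := sym_connect_sym (@adj_sym _ (threshold b)).
  apply: connect_trans (to_max i) _; rewrite csym; exact: to_max.
have /connectP[[|k p] /= kp e] := conn ord_max ord0; first by [].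
move: kp; rewrite /threshold_adj => /andP[+ _].
case: ltngtP => // mk _; by move: mk; rewrite ltnNge -ltnS ltn_ord.
Qed.

Definition dominating (n : nat) (b : n.-tuple bool) : {set 'I_n} :=
  [set i | tnth b i]%SET.

Definition isolated (n : nat) (b : n.-tuple bool) : {set 'I_n} :=
  [set i | ~~ tnth b i]%SET.

(* The block A(1bar, 0bar); its number of rows is the trace of b. *)
Definition dom_iso_mx (R : realType) (n : nat) (b : n.-tuple bool)
    (A : 'M[R]_n) : 'M[R]_(#|dominating b|, #|isolated b|) :=
  mxsub (fun i => enum_val i) (fun j => enum_val j) A.

Definition column_orthogonal (R : realType) (m n : nat) (M : 'M[R]_(m, n)) :=
  forall j k, j != k -> (col j M)^T *m col k M = 0.

(* Main.v *)
Require Import Defs.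
From HB Require Import structures.
From mathcomp Require Import all_boot all_order all_algebra.
From mathcomp Require Import finmap all_classical all_reals.
From mathcomp Require Import complex spectral lra.

(** If A in S(G) has eigenvalues a and b, then A^2 = (a + b) A - a b I, and the
    (i, j) entry of this identity, for isolated i <> j, says that columns i and
    j of A(1bar, 0bar) are orthogonal.  Conversely, let N be the column
    orthogonal block A(1bar, 0bar), and for each isolated j let w_j be the
    vector extending the column N_j by a single entry t_j <> 0 in position j.
    The w_j are orthogonal, so the sum of the w_j w_j^T / |w_j|^2 is a
    projection, and it has the right pattern except perhaps in the dominating
    block.  All dominating vertices are adjacent to v_1, so changing t_1 alone
    changes every off-diagonal entry of that block, and a large t_1 makes all
    of them nonzero. *)

Set Implicit Arguments.
Unset Strict Implicit.
Unset Printing Implicit Defensive.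

Import Order.TTheory GRing.Theory Num.Theory.

Local Open Scope ring_scope.

(** * Real symmetric matrices: spectral theorem and annihilating polynomials *)

Lemma symmetric_spectral (R : rcfType) (n : nat) (A : 'M[R]_n) : A^T = A ->
  exists2 P : 'M[R[i]]_n, P \in unitmx & exists d : 'rV[R]_n,
    map_mx (real_complex R) A =
      invmx P *m diag_mx (map_mx (real_complex R) d) *m P.
Proof.
move=> As; pose B := map_mx (real_complex R) A.
have Bh : B \is hermsymmx.
  apply: realsym_hermsym.
    apply/is_hermitianmxP; rewrite expr0 scale1r map_mx_id //.
    by rewrite /B map_trmx As.
  by apply/mxOverP => i j; rewrite mxE; apply/complex_realP; exists (A i j).
have /orthomx_spectralP BE := hermitian_normalmx Bh.
exists (spectralmx B); first exact: spectral_unit.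
exists (map_mx (@complex.Re R) (spectral_diag B)).
suff -> : map_mx (real_complex R) (map_mx (@complex.Re R) (spectral_diag B)) =
    spectral_diag B by exact: BE.
apply/matrixP => i j; rewrite !mxE RRe_real //.
by have /mxOverP := hermitian_spectral_diag_real Bh; apply.
Qed.

(** Conjugation by [P] turns p(A) into the diagonal matrix of the p(d_j), and each d_j is an
    eigenvalue, with row j of [P] as eigenvector. *)
Lemma symmetric_horner_mx0 (R : rcfType) (n : nat) (A : 'M[R]_n.+1)
    (p : {poly R}) :
  A^T = A -> (forall a, eigenvalue A a -> root p a) -> horner_mx A p = 0.
Proof.
move=> As Ap; have [P uP [d Ad]] := symmetric_spectral As.
apply: (map_mx_inj (f := real_complex R)).
rewrite map_horner_mx Ad horner_mx_uconjC // horner_mx_diag map_mx0.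
suff -> : map_mx (horner (map_poly (real_complex R) p))
    (map_mx (real_complex R) d) = 0 by rewrite linear0 mulmx0 mul0mx.
apply/rowP => j; rewrite !mxE horner_map; apply/eqP; rewrite fmorph_eq0.
apply: Ap; rewrite -(eigenvalue_map (real_complex R)) Ad.
apply/eigenvalueP; exists (row j P).
  rewrite -row_mul !mulmxA mulmxV // mul1mx row_mul row_diag_mx -scalemxAl.
  by rewrite -rowE mxE.
apply: contraTneq uP => Pj0; rewrite -row_free_unit.
by apply/row_freePn; exists j; rewrite Pj0 sub0mx.
Qed.

Lemma symmetric_prod_eigenvalues (R : realType) (n : nat) (A : 'M[R]_n.+1) :
  A^T = A ->
  exists2 s : seq R, size s = num_eigenvalues A &
    \prod_(a <- s) (A - a%:M) = 0.
Proof.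
move=> As; exists (fset_set [set a | eigenvalue A a]%classic) => //.
have <- : horner_mx A
    (\prod_(a <- fset_set [set a | eigenvalue A a]%classic) ('X - a%:P)) = 0.
  apply: symmetric_horner_mx0 => // a Aa.
  rewrite root_prod_XsubC in_fset_set ?inE //; exact: finite_eigenvalues.
rewrite rmorph_prod; apply: eq_bigr => a _.
by rewrite rmorphB /= horner_mx_X horner_mx_C.
Qed.

Lemma symmetric_num_eigenvalues1 (R : realType) (n : nat) (A : 'M[R]_n.+1) :
  A^T = A -> (num_eigenvalues A <= 1)%N -> is_scalar_mx A.
Proof.
move=> /symmetric_prod_eigenvalues[[|a [|b s]] <- //].
  (* An empty spectrum would make the identity matrix zero, which the size [n.+1] excludes. *)
  by rewrite big_nil => /eqP; rewrite oner_eq0.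
by rewrite big_seq1 => /subr0_eq -> _; apply: scalar_mx_is_scalar.
Qed.

Lemma symmetric_num_eigenvalues2 (R : realType) (n : nat) (A : 'M[R]_n.+1) :
  A^T = A -> num_eigenvalues A = 2%N ->
  exists c d : R, A *m A = c *: A + d%:M.
Proof.
move=> /symmetric_prod_eigenvalues[[|a [|b [|? ?]]] <- // E _].
rewrite big_cons big_seq1 in E.
have : (A - a%:M) *m (A - b%:M) = 0 by [].
rewrite mulmxBl !mulmxBr mul_mx_scalar !mul_scalar_mx scale_scalar_mx.
move=> /subr0_eq/(canRL (subrK _)) ->; exists (a + b), (- (a * b)).
by rewrite scalerDl raddfN /= addrAC.
Qed.

(** * Bounds on the number of eigenvalues *)

Lemma idempotent_num_eigenvalues (R : realType) (n : nat) (A : 'M[R]_n) :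
  A *m A = A -> (num_eigenvalues A <= 2)%N.
Proof.
move=> AA; apply: (@leq_trans #|` [fset (0 : R); 1]%fset|); last first.
  by rewrite cardfs2; case: (_ != _).
apply: fsubset_leq_card; apply/fsubsetP => a.
rewrite in_fset_set ?inE; last exact: finite_eigenvalues.
move=> /eigenvalueP[v vA v0].
have : a *: (a *: v) = a *: v by rewrite -{1}vA scalemxAl -vA -mulmxA AA.
move/eqP; rewrite scalerA -subr_eq0 -scalerBl scaler_eq0 (negPf v0) orbF.
by rewrite -[X in _ - X]mulr1 -mulrBr mulf_eq0 subr_eq0.
Qed.

Lemma symmx_of_num_eigenvalues (R : realType) (n : nat) (G : sgraph n.+1)
    (i j : 'I_n.+1) (A : 'M[R]_n.+1) :
  adj G i j -> symmx_of R G A -> (2 <= num_eigenvalues A)%N.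
Proof.
move=> Gij [As AG]; rewrite ltnNge; apply/negP.
move=> /(symmetric_num_eigenvalues1 As)/is_scalar_mxP[a Aa].
have ij : i != j by apply: contraTneq Gij => ->; rewrite adj_irr.
by have := AG _ _ ij; rewrite Gij Aa mxE (negPf ij) eqxx.
Qed.

(** An edge forces a nonzero off-diagonal entry, so no matrix of S(G) is scalar and the minimum is
    at least 2; only the upper bound remains. *)
Lemma graph_q_eq2 (R : realType) (n : nat) (G : sgraph n.+1) (i j : 'I_n.+1) :
  adj G i j ->
  graph_q R G = 2%N <->
  exists2 A : 'M[R]_n.+1, symmx_of R G A & (num_eigenvalues A <= 2)%N.
Proof.
move=> Gij; rewrite /graph_q; case: ex_minnP => k /asboolP[A GA Ak] kmin; split.
  by move=> k2; exists A => //; rewrite Ak k2.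
move=> [B GB B2]; apply/eqP; rewrite eqn_leq; apply/andP; split; last first.
  by rewrite -Ak (symmx_of_num_eigenvalues Gij GA).
by apply: leq_trans B2; apply: kmin; apply/asboolP; exists B.
Qed.

(** * Column orthogonality as sums over vertices *)

Lemma dom_iso_mx_orthogonalP (R : realType) (n : nat) (b : n.-tuple bool)
    (A : 'M[R]_n) :
  column_orthogonal (dom_iso_mx b A) <->
  (forall j k, ~~ tnth b j -> ~~ tnth b k -> j != k ->
    \sum_(i | tnth b i) A i j * A i k = 0).
Proof.
have E (j k : 'I_#|isolated b|) :
    ((col j (dom_iso_mx b A))^T *m col k (dom_iso_mx b A)) ord0 ord0 =
    \sum_(i | tnth b i) A i (enum_val j) * A i (enum_val k).
  transitivity (\sum_(i in dominating b) A i (enum_val j) * A i (enum_val k)).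
    by rewrite mxE [RHS]big_enum_val; apply: eq_bigr => i _; rewrite !mxE.
  by apply: eq_bigl => i; rewrite inE.
split=> [orth j k bj bk jk | orth j k jk].
  have ij : j \in isolated b by rewrite inE.
  have ik : k \in isolated b by rewrite inE.
  have := E (enum_rank_in ij j) (enum_rank_in ij k).
  rewrite !enum_rankK_in // => <-; rewrite orth ?mxE //.
  apply: contra_neq jk => /(congr1 enum_val).
  by rewrite !enum_rankK_in.
apply/matrixP => x y; rewrite !ord1 E mxE.
have := enum_valP j; have := enum_valP k; rewrite !inE => bk bj.
by apply: orth => //; apply: contra_neq jk => /enum_val_inj.
Qed.

(** * A denominator estimate, and projections built from orthogonal columns *)

Lemma exists_large_denominator (R : realFieldType) (I : finType) (P : pred I)
    (f g : I -> R) (s : R) :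
  0 <= s -> (forall i, P i -> f i != 0) ->
  exists2 t, t != 0 & forall i, P i -> f i / (s + t ^+ 2) + g i != 0.
Proof.
(* This makes t >= 1 and t > |f i / g i|. A vanishing sum would force g i != 0 and |f i / g i| = s +
   t^2 >= t. *)
move=> s0 f0; pose t := 1 + \sum_(i | P i) `|f i / g i|.
have S0 : 0 <= \sum_(i | P i) `|f i / g i| by apply: sumr_ge0.
have t1 : 1 <= t by rewrite lerDl.
exists t => [|i Pi]; first by rewrite gt_eqF //; lra.
have c0 : 0 < s + t ^+ 2 by nra.
apply/eqP => /eqP; rewrite addr_eq0 => /eqP E.
have fE : f i = - g i * (s + t ^+ 2) by rewrite -E divfK // gt_eqF.
have g0 : g i != 0.
  by have := f0 i Pi; apply: contraNneq => g0; rewrite fE g0 oppr0 mul0r.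
have : `|f i / g i| < t.
  rewrite /t (bigD1 i) //= addrCA ltrDl.
  by rewrite ltr_pwDl // sumr_ge0.
rewrite fE mulrAC mulNr mulfV // mulN1r normrN gtr0_norm //; nra.
Qed.

(* If column k vanishes then it contributes 0, as 0^-1 = 0. *)
Definition colproj_mx (R : realFieldType) (n : nat) (W : 'M[R]_n) : 'M[R]_n :=
  \matrix_(i, j) \sum_k W i k * W j k / \sum_l W l k ^+ 2.

Lemma colproj_mx_sym (R : realFieldType) (n : nat) (W : 'M[R]_n) :
  (colproj_mx W)^T = colproj_mx W.
Proof.
apply/matrixP => i j; rewrite !mxE; apply: eq_bigr => k _.
by rewrite [W j k * _]mulrC.
Qed.

Lemma colproj_mx_idem (R : realFieldType) (n : nat) (W : 'M[R]_n) :
  (forall j k, j != k -> \sum_i W i j * W i k = 0) ->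
  colproj_mx W *m colproj_mx W = colproj_mx W.
Proof.
move=> Wo; pose c := \row_k (\sum_l W l k ^+ 2)^-1.
have WE : colproj_mx W = W *m diag_mx c *m W^T.
  apply/matrixP => i j; rewrite mul_mx_diag !mxE; apply: eq_bigr => k _.
  by rewrite !mxE mulrAC.
(* By orthogonality [W^T *m W] is diagonal, with the squared column norms as entries. It remains to
   check c_i |w_i|^2 c_i = c_i, which for a zero column holds because c_i = 0^-1 = 0. *)
have -> : colproj_mx W *m colproj_mx W =
    W *m (diag_mx c *m (W^T *m W) *m diag_mx c) *m W^T by rewrite WE !mulmxA.
rewrite WE; congr (_ *m _ *m _); apply/matrixP => i j.
rewrite mul_mx_diag mxE mul_diag_mx !mxE.
have -> : \sum_k W^T i k * W k j = \sum_k W k i * W k j.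
  by apply: eq_bigr => k _; rewrite mxE.
have [<-|ij] := eqVneq i j; last by rewrite Wo // mulr0 mul0r.
rewrite mulr1n (eq_bigr (fun k => W k i ^+ 2)) => [|k _]; last by rewrite expr2.
have [->|c0] := eqVneq (\sum_l W l i ^+ 2) 0; first by rewrite invr0 mulr0.
by rewrite mulVf // mul1r.
Qed.

(** * The projection attached to a column orthogonal block *)

Lemma threshold_adjE (n : nat) (b : n.-tuple bool) (i j : 'I_n) : i != j ->
  threshold_adj b i j = tnth b (if (i < j)%N then j else i).
Proof.
by rewrite /threshold_adj -val_eqE /=; case: (ltngtP i j).
Qed.

(* Column j is the vector w_j, with t_1 = t and all other t_j = 1. *)
Definition bordered_block (R : realType) (n : nat) (b : n.+1.-tuple bool)
    (A : 'M[R]_n.+1) (t : R) : 'M[R]_n.+1 :=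
  \matrix_(i, j) if tnth b j then 0 else if tnth b i then A i j
                 else if i == j then if j == ord0 then t else 1 else 0.

Lemma bordered_block_orthogonal (R : realType) (n : nat) (b : n.+1.-tuple bool)
    (A : 'M[R]_n.+1) (t : R) :
  column_orthogonal (dom_iso_mx b A) ->
  forall j k, j != k ->
    \sum_i bordered_block b A t i j * bordered_block b A t i k = 0.
Proof.
move=> /dom_iso_mx_orthogonalP orth j k jk.
case bj: (tnth b j); first by rewrite big1 // => i _; rewrite !mxE bj mul0r.
case bk: (tnth b k); first by rewrite big1 // => i _; rewrite !mxE bk mulr0.
rewrite -[RHS](orth j k) ?bj ?bk // [RHS]big_mkcond; apply: eq_bigr => i _.
rewrite !mxE bj bk; case: (tnth b i) => //.
by have [->|_] := eqVneq i j; rewrite ?mul0r // (negPf jk) mulr0.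
Qed.

(** For isolated i, row i of [W] is zero off the diagonal, so entry (i, j) of the projection reduces
    to W i i * W j i / |w_i|^2, which vanishes exactly when W j i does. *)
Lemma colproj_bordered_block_symmx_of (R : realType) (n : nat)
    (b : n.+1.-tuple bool) (A : 'M[R]_n.+1) (t : R) :
  symmx_of R (threshold b) A -> t != 0 ->
  (forall i j, tnth b i -> tnth b j -> i != j ->
    colproj_mx (bordered_block b A t) i j != 0) ->
  symmx_of R (threshold b) (colproj_mx (bordered_block b A t)).
Proof.
move=> [As AG] t0 Bdom; set W := bordered_block b A t.
have Bs := colproj_mx_sym W; split=> // i j.
(* Distinct dominating vertices are adjacent, and [Bdom] covers them; any other pair has an isolated
   member, taken to be i by symmetry. *)
wlog bi : i j / ~~ tnth b i => [th|] ij.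
  case bi: (tnth b i); last by apply: th; rewrite ?bi.
  case bj: (tnth b j); last first.
    by rewrite -{1}Bs mxE adj_sym; apply: th; rewrite ?bj // eq_sym.
  by rewrite Bdom //= threshold_adjE //; case: ifP; rewrite ?bi ?bj.
have Wi k : k != i -> W i k = 0.
  by move=> ki; rewrite mxE (negPf bi) eq_sym (negPf ki); case: ifP.
have Wii : W i i != 0.
  by rewrite mxE (negPf bi) eqxx; case: ifP; rewrite ?oner_eq0.
have ci : \sum_l W l i ^+ 2 != 0.
  rewrite gt_eqF // (bigD1 i) //= ltr_pwDl ?sumr_ge0 // => [|l _].
    by rewrite exprn_even_gt0.
  exact: sqr_ge0.
rewrite mxE (bigD1 i) //= [X in _ + X]big1 ?addr0 => [|k ki]; last by rewrite Wi ?mul0r.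
rewrite mulf_eq0 invr_eq0 (negPf ci) orbF mulf_eq0 (negPf Wii) /= mxE.
rewrite (negPf bi); have ji : j != i by rewrite eq_sym.
case bj: (tnth b j); first by rewrite AG //= threshold_adj_sym.
rewrite (negPf ji) eqxx threshold_adjE //.
by case: ifP; rewrite ?bj ?(negPf bi).
Qed.

Lemma exists_colproj_bordered_block (R : realType) (n : nat)
    (b : n.+1.-tuple bool) (A : 'M[R]_n.+1) :
  tnth b ord0 = false -> symmx_of R (threshold b) A ->
  exists2 t, t != 0 & forall i j, tnth b i -> tnth b j ->
    colproj_mx (bordered_block b A t) i j != 0.
Proof.
move=> b0 [As AG].
have A0 i : tnth b i -> A i ord0 != 0.
  move=> bi; have i0 : i != ord0 by apply: contraTneq bi => ->; rewrite b0.
  by rewrite AG //= threshold_adjE.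
(* The parameter t sits only at position ([ord0], [ord0]), which [g] and [s] avoid, so the value 1
   is arbitrary. Column [ord0] contributes f p / (s + t^2) to entry p of the projection, and [g]
   collects the other columns. *)
pose V := bordered_block b A 1.
pose P (p : 'I_n.+1 * 'I_n.+1) := tnth b p.1 && tnth b p.2.
pose f (p : 'I_n.+1 * 'I_n.+1) := A p.1 ord0 * A p.2 ord0.
pose g (p : 'I_n.+1 * 'I_n.+1) :=
  \sum_(k | k != ord0) V p.1 k * V p.2 k / \sum_l V l k ^+ 2.
pose s := \sum_(l | l != ord0) V l ord0 ^+ 2.
have s0 : 0 <= s by apply: sumr_ge0 => l _; apply: sqr_ge0.
have f0 p : P p -> f p != 0.
  by case/andP => p1 p2; rewrite mulf_neq0 ?A0.
have [t t0 H] := exists_large_denominator g s0 f0.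
exists t => // i j bi bj; have := H (i, j); rewrite /P /= bi bj => /(_ isT).
rewrite mxE (bigD1 ord0) //= (bigD1 (P := xpredT) ord0) //=.
congr (_ + _ != 0); first congr (_ / _).
- by rewrite !mxE b0 bi bj.
- rewrite [LHS]addrC; congr (_ + _); first by rewrite !mxE b0 eqxx.
  by apply: eq_bigr => l l0; rewrite !mxE (negPf l0).
- apply: eq_bigr => k k0; rewrite !mxE (negPf k0); congr (_ / _).
  by apply: eq_bigr => l _; rewrite !mxE (negPf k0).
Qed.

(** * The two implications *)

Lemma two_eigenvalues_column_orthogonal (R : realType) (n : nat)
    (b : n.+1.-tuple bool) (A : 'M[R]_n.+1) :
  symmx_of R (threshold b) A -> num_eigenvalues A = 2%N ->
  column_orthogonal (dom_iso_mx b A).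
Proof.
move=> [As AG] A2; apply/dom_iso_mx_orthogonalP => j k bj bk jk.
have iso0 i l : ~~ tnth b i -> ~~ tnth b l -> i != l -> A i l = 0.
  move=> bi bl il; apply: contraTeq isT => Ail; have := AG _ _ il.
  rewrite Ail /= threshold_adjE //.
  by case: ifP; rewrite ?(negPf bi) ?(negPf bl).
have Asym i l : A i l = A l i by rewrite -{1}As mxE.
have [c [d /matrixP/(_ j k)]] := symmetric_num_eigenvalues2 As A2.
rewrite !mxE (iso0 j k) // mulr0 (negPf jk) addr0 => AA.
(* An isolated i differs from j or from k, and distinct isolated vertices are nonadjacent, so its
   term in the entry of A^2 vanishes. *)
rewrite -[RHS]AA [LHS]big_mkcond; apply: eq_bigr => i _.
case: ifPn => [_|bi]; first by rewrite (Asym j).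
have [->|ij] := eqVneq i j; first by rewrite (iso0 j k) ?mulr0.
by rewrite (iso0 j i) ?mul0r // eq_sym.
Qed.

Theorem theorem4p1 (R : realType) (n : nat) (b : n.+1.-tuple bool)
    (b_first : tnth b ord0 = false) (b_last : tnth b ord_max = true) :
  graph_q R (threshold b) = 2%N <->
  exists2 A : 'M[R]_n.+1,
    symmx_of R (threshold b) A & column_orthogonal (dom_iso_mx b A).
Proof.
(* [b] takes different values at [ord0] and [ord_max], so these vertices are distinct, and [b_last]
   makes them adjacent. *)
have edge : adj (threshold b) ord_max ord0.
  rewrite /= threshold_adjE //=.
  by apply: contraTneq b_last => ->; rewrite b_first.
rewrite (graph_q_eq2 R edge); split=> [[A GA A2] | [A GA orth]].
  exists A => //; apply: two_eigenvalues_column_orthogonal => //.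
  by apply/eqP; rewrite eqn_leq A2 (symmx_of_num_eigenvalues edge GA).
have [t t0 Bdom] := exists_colproj_bordered_block b_first GA.
exists (colproj_mx (bordered_block b A t)).
  by apply: colproj_bordered_block_symmx_of => // i j bi bj _; apply: Bdom.
apply/idempotent_num_eigenvalues/colproj_mx_idem.
exact: bordered_block_orthogonal.
Qed.
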